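(* Consider the following four families of four-dimensional Lorentzian metric Lie algebras (only non-zero brackets and non-zero inner products of the basis $\{u_1,u_2,u_3,u_4\}$ are listed; all parameters are real). (a) $[u_1,u_2]=u_3$, $[u_1,u_4]=\kappa_1u_1-\kappa_2u_2+\kappa_3u_3$, $[u_2,u_4]=\kappa_2u_1+\kappa_4u_2+\kappa_5u_3$, $[u_3,u_4]=(\kappa_1+\kappa_4)u_3$, with $\langle u_1,u_1\rangle=\langle u_2,u_2\rangle=\langle u_3,u_4\rangle=1$ and $4\kappa_1\kappa_4+1\neq 0$. (b) $[u_2,u_4]=(1-\kappa)u_3$, $[u_3,u_4]=(\kappa+1)u_1$, with $\langle u_1,u_2\rangle=\langle u_3,u_3\rangle=\langle u_4,u_4\rangle=1$ and $\kappa\neq 0$. (c) $[u_1,u_4]=\kappa_1u_1-\kappa_2u_2+\kappa_3u_3$, $[u_2,u_4]=\kappa_2u_1+\kappa_4u_2+\kappa_5u_3$, $[u_3,u_4]=\kappa_6u_3$, with $\langle u_1,u_1\rangle=\langle u_2,u_2\rangle=\langle u_3,u_4\rangle=1$ and $\kappa_1^2+\kappa_4^2-(\kappa_1+\kappa_4)\kappa_6\neq 0$. (d) $[u_1,u_3]=u_2$, $[u_2,u_3]=-u_1$, $[u_1,u_4]=\kappa_1u_1+\kappa_2u_2$, $[u_2,u_4]=-\kappa_2u_1+\kappa_1u_2$, with $\langle u_1,u_1\rangle=\langle u_2,u_2\rangle=\langle u_3,u_4\rangle=1$ and $\kappa_1\neq 0$. Then all the left-invariant metrics in families (a), (b) and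 (c) are steady algebraic Ricci solitons, while those in family (d) are not algebraic Ricci solitons.
   Context: A metric Lie algebra $(\mathfrak{g},\langle\cdot,\cdot\rangle)$ determines a left-invariant metric on the corresponding connected and simply connected Lie group. Let $\operatorname{Ric}$ be the Ricci operator, $\langle \operatorname{Ric}x,y\rangle=\rho(x,y)$, where $\rho$ is the Ricci tensor. It is an algebraic Ricci soliton if there is a constant $\mu\in\mathbb{R}$ such that $\operatorname{Ric}-\mu\operatorname{Id}$ is a derivation of $\mathfrak{g}$; it is a steady algebraic Ricci soliton if this holds with $\mu=0$, i.e. if $\operatorname{Ric}$ is a derivation of $\mathfrak{g}$. (The four families are the non-Einstein plane wave left-invariant metrics in dimension four.) *)

(* Defs.v *)
From HB Require Import structures.
From mathcomp Require Import all_boot all_order all_algebra.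
From mathcomp Require Import boolp classical_sets reals.

Set Implicit Arguments.
Unset Strict Implicit.
Unset Printing Implicit Defensive.

Import Order.TTheory GRing.Theory Num.Theory.

Local Open Scope ring_scope.

Record metric_lie_algebra (R : realType) := MetricLieAlgebra {
  carrier :> vectType R;
  bracket : {bilinear carrier -> carrier -> carrier};
  bracket_alt : forall x, bracket x x = 0;
  bracket_jacobi : forall x y z,
    bracket x (bracket y z) + bracket y (bracket z x)
    + bracket z (bracket x y) = 0;
  inner : {symmetric carrier};
  inner_nondegenerate : nondegenerate inner
}.

Notation "[< x , y >]" := (bracket _ x y)
  (at level 0, x at level 99, y at level 99, format "[<  x ,  y  >]") : ring_scope.
Notation "''[' x , y ]" := (inner _ x y) : ring_scope.

Section Geometry.
Variables (R : realType) (g : metric_lie_algebra R).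
Implicit Types x y z : g.

(* Signature (n - 1, 1): there is an orthonormal basis whose first vector t is
   timelike and whose other vectors are spacelike. *)
Definition lorentzian : Prop :=
  exists (t : g) (s : seq g),
    [/\ basis_of {:g} (t :: s),
        '[t, t] = -1,
        {in s, forall x, '[t, x] = 0}
      & {in s &, forall x y, '[x, y] = (x == y)%:R}].

(* The vector representing the linear form phi. It exists and is unique by
   nondegeneracy; the value is 0 if phi is not linear. *)
Definition sharp (phi : g -> R) : g :=
  xget 0 [set v : g | forall z, '[v, z] = phi z].

Definition trace (f : g -> g) : R :=
  \sum_i coord (vbasis {:g}) i (f (vbasis {:g})`_i).

(* Elements of g stand for left-invariant vector fields, and the objects below
   are those of the left-invariant metric. Inner products of left-invariant
   fields are constant, so only the bracket terms of the Koszul formula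
   remain. *)
Definition nabla x y : g :=
  sharp (fun z => 2^-1 * ('[[<x, y>], z] - '[[<y, z>], x]
                          + '[[<z, x>], y])).

Definition curvature x y z : g :=
  nabla x (nabla y z) - nabla y (nabla x z) - nabla [<x, y>] z.

Definition ricci_tensor x y : R := trace (fun z => curvature z x y).

Definition ricci_operator x : g := sharp (ricci_tensor x).

Definition derivation (D : g -> g) : Prop :=
  linear D /\ forall x y, D [<x, y>] = [<D x, y>] + [<x, D y>].

Definition algebraic_ricci_soliton_with (mu : R) : Prop :=
  derivation (fun x => ricci_operator x - mu *: x).

Definition algebraic_ricci_soliton : Prop :=
  exists mu : R, algebraic_ricci_soliton_with mu.

Definition steady_algebraic_ricci_soliton : Prop :=
  algebraic_ricci_soliton_with 0.

Variables u1 u2 u3 u4 : g.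

Definition inner_table_acd : Prop :=
  [/\ [/\ '[u1, u1] = 1, '[u1, u2] = 0, '[u1, u3] = 0 & '[u1, u4] = 0],
      [/\ '[u2, u2] = 1, '[u2, u3] = 0 & '[u2, u4] = 0],
      '[u3, u3] = 0 /\ '[u3, u4] = 1
    & '[u4, u4] = 0].

Definition inner_table_b : Prop :=
  [/\ [/\ '[u1, u1] = 0, '[u1, u2] = 1, '[u1, u3] = 0 & '[u1, u4] = 0],
      [/\ '[u2, u2] = 0, '[u2, u3] = 0 & '[u2, u4] = 0],
      '[u3, u3] = 1 /\ '[u3, u4] = 0
    & '[u4, u4] = 1].

Definition family_a (k1 k2 k3 k4 k5 : R) : Prop :=
  [/\ [/\ [<u1, u2>] = u3, [<u1, u3>] = 0
        & [<u1, u4>] = k1 *: u1 - k2 *: u2 + k3 *: u3],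
      [/\ [<u2, u3>] = 0, [<u2, u4>] = k2 *: u1 + k4 *: u2 + k5 *: u3
        & [<u3, u4>] = (k1 + k4) *: u3],
      inner_table_acd
    & 4 * k1 * k4 + 1 != 0].

Definition family_b (k : R) : Prop :=
  [/\ [/\ [<u1, u2>] = 0, [<u1, u3>] = 0
        & [<u1, u4>] = 0],
      [/\ [<u2, u3>] = 0, [<u2, u4>] = (1 - k) *: u3
        & [<u3, u4>] = (k + 1) *: u1],
      inner_table_b
    & k != 0].

Definition family_c (k1 k2 k3 k4 k5 k6 : R) : Prop :=
  [/\ [/\ [<u1, u2>] = 0, [<u1, u3>] = 0
        & [<u1, u4>] = k1 *: u1 - k2 *: u2 + k3 *: u3],
      [/\ [<u2, u3>] = 0, [<u2, u4>] = k2 *: u1 + k4 *: u2 + k5 *: u3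
        & [<u3, u4>] = k6 *: u3],
      inner_table_acd
    & k1 ^+ 2 + k4 ^+ 2 - (k1 + k4) * k6 != 0].

Definition family_d (k1 k2 : R) : Prop :=
  [/\ [/\ [<u1, u2>] = 0, [<u1, u3>] = u2
        & [<u1, u4>] = k1 *: u1 + k2 *: u2],
      [/\ [<u2, u3>] = - u1, [<u2, u4>] = - k2 *: u1 + k1 *: u2
        & [<u3, u4>] = 0],
      inner_table_acd
    & k1 != 0].

End Geometry.

(* Main.v *)
From HB Require Import structures.
Require Import Defs.
From mathcomp Require Import all_boot all_order all_algebra.
From mathcomp Require Import boolp classical_sets reals.
From mathcomp Require Import ring lra.

Import Order.TTheory GRing.Theory Num.Theory.

Local Open Scope ring_scope.

(** All four families are instances of one pattern. In a basis with
    <u1, u1> = <u2, u2> = <u3, u4> = 1 and the other inner products zero, let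
    [u1, u2] = delta u3, let ad u4 act by an arbitrary matrix on u1, u2 modulo
    u3, let [u3, u4] = k6 u3, and let ad u3 act by a rotation of speed eps on
    u1, u2; if eps != 0, let moreover delta = 0 and let ad u4 act conformally.
    The Ricci operator is then x |-> C <x, u3> u3 for a constant C,
    which is a derivation when eps = 0. In family (d), where eps = 1 and
    C = -2 k1^2, the Leibniz rule for Ric - mu Id on [u1, u3] = u2 forces
    mu = 0, and then on [u1, u4] it forces C = 0. *)

(** * Representing vectors and traces *)

Section General.
Local Set Implicit Arguments.
Local Unset Strict Implicit.
Variables (R : realType) (g : metric_lie_algebra R).
Implicit Types (x y z v : g) (a b c d : R).

Lemma innerC x y : '[x, y] = '[y, x].
Proof. by rewrite hermC expr0 mul1r. Qed.

Lemma bracketN x y : [<x, y>] = - [<y, x>].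
Proof.
have := bracket_alt (x + y).
rewrite linearDl !linearDr /= !bracket_alt add0r addr0 => /eqP.
by rewrite addr_eq0 => /eqP.
Qed.

Lemma inner_inj v v' : (forall z, '[v, z] = '[v', z]) -> v = v'.
Proof.
move=> eq_v; apply/eqP; rewrite -subr_eq0 -memv0.
have /eqP <- := inner_nondegenerate g.
by apply/mem_orthovP => z _; rewrite linearBl /= eq_v subrr.
Qed.

(** Nondegeneracy leaves at most one representing vector, so an explicit candidate for [nabla] or
    [ricci_operator] need only be tested against every [z]. *)
Lemma sharp_eq (phi : g -> R) v : (forall z, '[v, z] = phi z) -> sharp phi = v.
Proof.
move=> v_phi; apply: xget_unique => // v' v'_phi.
by apply: inner_inj => z; rewrite v_phi v'_phi.
Qed.

(** Expanding each [f e_j] in [vbasis] on one side, and the vectors of [vbasis] in [e] on the other,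
    gives the same double sum. *)
Lemma trace_basis (n : nat) (e : n.-tuple g) (f : g -> g) :
  linear f -> basis_of {:g} e -> trace f = \sum_i coord e i (f e`_i).
Proof.
move=> f_lin e_basis.
pose Lf := GRing.isLinear.Build _ _ _ _ f f_lin.
pose F : {linear g -> g} := HB.pack f Lf.
have fE j : f e`_j = \sum_i coord (vbasis {:g}) i (F e`_j) *: (vbasis {:g})`_i.
  exact: (coord_vbasis (memvf _)).
under [RHS]eq_bigr => j _ do rewrite fE linear_sum /=.
rewrite exchange_big; apply: eq_bigr => i _ /=.
rewrite -[f _]/(F _) {1}(coord_basis e_basis (memvf (vbasis {:g})`_i)).
rewrite !linear_sum; apply: eq_bigr => j _.
by rewrite !linearZ /= mulrC.
Qed.

End General.

(** * Coordinates in a fixed frame *)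

Section Frame.
Local Set Implicit Arguments.
Local Unset Strict Implicit.
Variables (R : realType) (g : metric_lie_algebra R) (u1 u2 u3 u4 : g).
Implicit Types (x y z v : g) (a b c d : R).

(** A normal form: once both sides have it, an identity of vectors splits into four scalar
    identities. *)
Definition combination a b c d : g := a *: u1 + b *: u2 + c *: u3 + d *: u4.
Local Notation V := combination.

Lemma combinationD a b c d a' b' c' d' :
  V a b c d + V a' b' c' d' = V (a + a') (b + b') (c + c') (d + d').
Proof. by rewrite /V !scalerDl (addrACA _ (d *: u4)) (addrACA _ (c *: u3)) (addrACA (a *: u1)). Qed.

Lemma combinationZ r a b c d : r *: V a b c d = V (r * a) (r * b) (r * c) (r * d).
Proof. by rewrite /V !scalerDr !scalerA. Qed.

Lemma combinationN a b c d : - V a b c d = V (- a) (- b) (- c) (- d).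
Proof. by rewrite -scaleN1r combinationZ !mulN1r. Qed.

Lemma combination1 : u1 = V 1 0 0 0.
Proof. by rewrite /V scale1r !scale0r !addr0. Qed.

Lemma combination2 : u2 = V 0 1 0 0.
Proof. by rewrite /V scale1r !scale0r !addr0 add0r. Qed.

Lemma combination3 : u3 = V 0 0 1 0.
Proof. by rewrite /V scale1r !scale0r !addr0 !add0r. Qed.

Lemma combination4 : u4 = V 0 0 0 1.
Proof. by rewrite /V scale1r !scale0r !add0r. Qed.

Hypothesis u_basis : basis_of {:g} [:: u1; u2; u3; u4].

Lemma combinationP x : exists a b c d, x = V a b c d.
Proof.
pose e := [tuple u1; u2; u3; u4].
have := @coord_basis _ _ _ _ e _ u_basis (memvf x).
rewrite !big_ord_recl big_ord0 addr0 /= !addrA => ->.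
by do 4 eexists.
Qed.

Hypothesis u_inner : inner_table_acd u1 u2 u3 u4.

Lemma inner_combination a b c d a' b' c' d' :
  '[V a b c d, V a' b' c' d'] = a * a' + b * b' + c * d' + d * c'.
Proof.
case: u_inner => -[i11 i12 i13 i14] [i22 i23 i24] [i33 i34] i44.
rewrite /V !linearDl /= !linearDr /= !linearZl_LR /= !linearZr_LR /=.
rewrite (innerC u2 u1) (innerC u3 u1) (innerC u4 u1) (innerC u3 u2).
rewrite (innerC u4 u2) (innerC u4 u3).
by rewrite i11 i12 i13 i14 i22 i23 i24 i33 i34 i44; ring.
Qed.

(** The frame dual to u1, u2, u3, u4 is u1, u2, u4, u3, so the diagonal coordinates are these inner
    products. *)
Lemma trace_combination (f : g -> g) : linear f ->
  trace f = '[f u1, u1] + '[f u2, u2] + '[f u3, u4] + '[f u4, u3].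
Proof.
move=> f_lin; pose e := [tuple u1; u2; u3; u4].
have coordE (i : 'I_4) a b c d : coord e i (V a b c d) = [:: a; b; c; d]`_i.
  have -> : V a b c d = \sum_(j < 4) [:: a; b; c; d]`_j *: e`_j.
    by rewrite !big_ord_recl big_ord0 addr0 /= !addrA.
  by rewrite coord_sum_free // (basis_free u_basis).
rewrite (@trace_basis _ _ _ e) // !big_ord_recl big_ord0 addr0 /= !addrA.
have [a [b [c [d ->]]]] := combinationP (f u1).
have [a' [b' [c' [d' ->]]]] := combinationP (f u2).
have [a'' [b'' [c'' [d'' ->]]]] := combinationP (f u3).
have [a3 [b3 [c3 [d3 ->]]]] := combinationP (f u4).
rewrite !coordE /= combination1 combination2 combination3 combination4.
rewrite !inner_combination.
ring.
Qed.

(** * Brackets and the Levi-Civita connection *)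

Variables delta a11 a12 a21 a22 k3 k5 k6 eps : R.
Hypothesis u_bracket :
  [/\ [/\ [<u1, u2>] = delta *: u3, [<u1, u3>] = eps *: u2
        & [<u1, u4>] = a11 *: u1 + a21 *: u2 + k3 *: u3],
      [<u2, u3>] = - eps *: u1,
      [<u2, u4>] = a12 *: u1 + a22 *: u2 + k5 *: u3
    & [<u3, u4>] = k6 *: u3].

Lemma bracket_combination a b c d a' b' c' d' :
  [<V a b c d, V a' b' c' d'>] =
  V (a11 * (a * d' - d * a') + a12 * (b * d' - d * b')
     - eps * (b * c' - c * b'))
    (a21 * (a * d' - d * a') + a22 * (b * d' - d * b')
     + eps * (a * c' - c * a'))
    (delta * (a * b' - b * a') + k3 * (a * d' - d * a')
     + k5 * (b * d' - d * b') + k6 * (c * d' - d * c')) 0.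
Proof.
case: u_bracket => -[b12 b13 b14] b23 b24 b34.
rewrite {1 2}/V !linearDl /= !linearDr /= !linearZl_LR /= !linearZr_LR /=.
rewrite (bracketN u2 u1) (bracketN u3 u1) (bracketN u4 u1) (bracketN u3 u2).
rewrite (bracketN u4 u2) (bracketN u4 u3) !bracket_alt.
rewrite b12 b13 b14 b23 b24 b34.
rewrite combination1 combination2 combination3.
rewrite !(combinationZ, combinationN, combinationD, scaler0, addr0, add0r).
by congr V; ring.
Qed.

Local Notation h := (2^-1 : R).

(** The four coordinates are the values of the Koszul form on the dual frame u1, u2, u4, u3. *)
Lemma nabla_combination a b c d a' b' c' d' :
  nabla (V a b c d) (V a' b' c' d') =
  V (a11 * a * d' + h * (a12 + a21) * b * d' + h * delta * (b * d' + d * b')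
     + h * (a21 - a12) * d * b' + eps * c * b' + k3 * d * d')
    (a22 * b * d' + h * (a12 + a21) * a * d' - h * delta * (a * d' + d * a')
     + h * (a12 - a21) * d * a' - eps * c * a' + k5 * d * d')
    (- a11 * a * a' - a22 * b * b' - h * (a12 + a21) * (a * b' + b * a')
     + h * delta * (a * b' - b * a') - k3 * d * a' - k5 * d * b'
     - k6 * d * c')
    (k6 * d * d').
Proof.
apply: sharp_eq => z; have [a0 [b0 [c0 [d0 ->]]]] := combinationP z.
by rewrite !bracket_combination !inner_combination; field.
Qed.

(** * Ricci curvature and the Leibniz rule *)

Hypothesis eps_cond : eps = 0 \/ [/\ delta = 0, a22 = a11 & a12 = - a21].

(** Let A = (a_ij) be the matrix of [x |-> [<x, u4>]] on u1, u2 modulo u3, and S its symmetric part: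
    this is delta^2/2 - tr(S^2) + k6 tr A. It equals (4 k1 k4 + 1)/2 in family (a), 2k in (b) and
    -(k1^2 + k4^2 - (k1 + k4) k6) in (c), so the inequation of each family says that it is
    nonzero. *)
Definition ricci_coef : R :=
  h * delta ^+ 2 - h * (a12 + a21) ^+ 2 - a11 ^+ 2 - a22 ^+ 2
  + (a11 + a22) * k6.

Lemma curvature_linear x y : linear (fun z => curvature z x y).
Proof.
move=> r z z'.
have [a [b [c [d ->]]]] := combinationP x.
have [a' [b' [c' [d' ->]]]] := combinationP y.
have [p [q [s [t ->]]]] := combinationP z.
have [p' [q' [s' [t' ->]]]] := combinationP z'.
rewrite /curvature !(combinationZ, combinationD, combinationN,
  bracket_combination, nabla_combination).
congr V; ring.
Qed.

Lemma ricci_tensorE x y : ricci_tensor x y = ricci_coef * '[x, u3] * '[y, u3].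
Proof.
rewrite /ricci_tensor trace_combination; last exact: curvature_linear.
have [a [b [c [d ->]]]] := combinationP x.
have [a' [b' [c' [d' ->]]]] := combinationP y.
rewrite /curvature combination1 combination2 combination3 combination4.
rewrite !(combinationN, combinationD, bracket_combination, nabla_combination).
rewrite !inner_combination /ricci_coef.
(* Either alternative cancels the terms in [eps], leaving a multiple of the product of the
   u4-coordinates. *)
by case: eps_cond => [->|[-> -> ->]]; field.
Qed.

Lemma ricci_operatorE x : ricci_operator x = ricci_coef * '[x, u3] *: u3.
Proof.
by apply: sharp_eq => z; rewrite linearZl_LR /= ricci_tensorE (innerC z).
Qed.

(* Both sides of the Leibniz rule vanish: the derived algebra is orthogonal to
   u3, and [u3, y] = k6 <y, u3> u3. *)
Lemma ricci_steady : eps = 0 -> steady_algebraic_ricci_soliton g.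
Proof.
move=> eps0; split.
  move=> r x y; rewrite !scale0r !subr0 !ricci_operatorE.
  rewrite linearDl /= linearZl_LR /= scalerA -scalerDl.
  by congr (_ *: _); ring.
move=> x y; rewrite !scale0r !subr0 !ricci_operatorE.
have [a [b [c [d ->]]]] := combinationP x.
have [a' [b' [c' [d' ->]]]] := combinationP y.
rewrite combination3 !(bracket_combination, inner_combination, combinationZ).
rewrite combinationD eps0; congr V; ring.
Qed.

Lemma ricci_not_soliton :
  eps != 0 -> ricci_coef != 0 -> ~ algebraic_ricci_soliton g.
Proof.
move=> eps_neq0 coef_neq0 [mu [_ leibniz]].
(* Ric kills u1, u2 and u3, all orthogonal to u3, so the rule reads -mu eps u2 = -2 mu eps u2. *)
have mu0 : mu = 0.
  have /(congr1 (fun v => '[v, u2])) := leibniz u1 u3.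
  rewrite !ricci_operatorE combination1 combination2 combination3.
  rewrite !(bracket_combination, inner_combination, combinationZ,
    combinationN, combinationD) => eq_mu.
  suff /eqP : mu * eps = 0 by rewrite mulf_eq0 (negPf eps_neq0) orbF => /eqP.
  by lra.
(* Ric kills u1 and [u1, u4], while Ric u4 = C u3; what remains is 0 = C [u1, u3] = C eps u2. *)
have /(congr1 (fun v => '[v, u2])) := leibniz u1 u4.
rewrite !ricci_operatorE mu0 combination1 combination2 combination3 combination4.
rewrite !(bracket_combination, inner_combination, combinationZ,
  combinationN, combinationD) => eq_coef.
suff /eqP : ricci_coef * eps = 0.
  by rewrite mulf_eq0 (negPf eps_neq0) (negPf coef_neq0).
by lra.
Qed.

End Frame.

(** * The four families as instances of the pattern *)

Theorem mainTheorem5 (R : realType) (g : metric_lie_algebra R)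
    (g_lorentzian : lorentzian g) (u1 u2 u3 u4 : g)
    (u_basis : basis_of {:g} [:: u1; u2; u3; u4]) :
  (forall k1 k2 k3 k4 k5 : R,
     family_a u1 u2 u3 u4 k1 k2 k3 k4 k5 -> steady_algebraic_ricci_soliton g) /\
  (forall k : R,
     family_b u1 u2 u3 u4 k -> steady_algebraic_ricci_soliton g) /\
  (forall k1 k2 k3 k4 k5 k6 : R,
     family_c u1 u2 u3 u4 k1 k2 k3 k4 k5 k6 -> steady_algebraic_ricci_soliton g) /\
  (forall k1 k2 : R,
     family_d u1 u2 u3 u4 k1 k2 -> ~ algebraic_ricci_soliton g).
Proof.
split=> [k1 k2 k3 k4 k5|].
  case=> -[b12 b13 b14] [b23 b24 b34] inner_table _.
  apply: (ricci_steady u_basis inner_table (delta := 1) (a11 := k1)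
    (a12 := k2) (a21 := - k2) (a22 := k4) (k3 := k3) (k5 := k5)
    (k6 := k1 + k4) (eps := 0)) => //; last by left.
  by rewrite oppr0 !scale0r scale1r scaleNr.
split=> [k|].
  case=> -[b12 b13 b14] [b23 b24 b34].
  case=> -[i11 i12 i13 i14] [i22 i23 i24] [i33 i34] i44 _.
  (* In the frame [u3, u4, u1, u2] this is the same pattern as (a) and (c). *)
  have basis' : basis_of {:g} [:: u3; u4; u1; u2].
    rewrite (@perm_basis _ _ _ [:: u1; u2; u3; u4]) //.
    by rewrite (perm_catC [:: u3; u4] [:: u1; u2]).
  have inner_table : inner_table_acd u3 u4 u1 u2.
    by split; [split | split | split | ]; rewrite // innerC.
  (* [delta] comes from [u3, u4] = (k + 1) u1, and [a12] from [u4, u2] = (k - 1) u3. *)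
  apply: (ricci_steady basis' inner_table (delta := k + 1) (a11 := 0)
    (a12 := k - 1) (a21 := 0) (a22 := 0) (k3 := 0) (k5 := 0)
    (k6 := 0) (eps := 0)) => //; last by left.
  rewrite (bracketN u3 u1) (bracketN u3 u2) (bracketN u4 u1) (bracketN u4 u2).
  by rewrite b12 b13 b14 b23 b24 b34 !(oppr0, scale0r, addr0) -scaleNr opprB.
split=> [k1 k2 k3 k4 k5 k6|k1 k2].
  case=> -[b12 b13 b14] [b23 b24 b34] inner_table _.
  apply: (ricci_steady u_basis inner_table (delta := 0) (a11 := k1)
    (a12 := k2) (a21 := - k2) (a22 := k4) (k3 := k3) (k5 := k5)
    (k6 := k6) (eps := 0)) => //; last by left.
  by rewrite oppr0 !scale0r scaleNr.
case=> -[b12 b13 b14] [b23 b24 b34] inner_table k1_neq0.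
apply: (ricci_not_soliton u_basis inner_table (delta := 0) (a11 := k1)
  (a12 := - k2) (a21 := k2) (a22 := k1) (k3 := 0) (k5 := 0)
  (k6 := 0) (eps := 1)); rewrite ?oner_neq0 //; last 2 first.
- by right.
- have -> : ricci_coef 0 k1 (- k2) k2 k1 0 = -2 * k1 ^+ 2 by rewrite /ricci_coef; ring.
  by rewrite mulf_neq0 ?expf_neq0 // oppr_eq0 pnatr_eq0.
by rewrite b12 b13 b14 b23 b24 b34 !(scale0r, addr0) scale1r scaleN1r.
Qed.
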